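(* Let a real Lie group $G$ have a $C^\infty$ action on a manifold $M$. Assume the $G$-action on $M$ is component effective. Let $\ell\in\{1,2,3,\ldots\}$ and let $x\in\mathcal F^\ell M$. Then $\mathrm{Stab}_G(x)$ (for the prolonged action of $G$ on $\mathcal F^\ell M$) has no nontrivial compact subgroups.
   Context: Manifolds are $C^\infty$ real manifolds (not assumed connected). Actions are left actions. $\mathrm{Stab}_G(x):=\{g\in G\mid gx=x\}$. $\mathcal F^kM$ denotes the $k$th order frame bundle of $M$: its points over $p\in M$ are the $k$-jets at $0$ of local diffeomorphisms $\varphi$ from a neighborhood of $0$ in $\mathbb R^{\dim M}$ to $M$ with $\varphi(0)=p$. A $C^\infty$ action of $G$ on $M$ induces (by differentiation, ''prolongation'') a $G$-action on $\mathcal F^kM$, $g\cdot j^k_0\varphi=j^k_0(g\circ\varphi)$. An action of a group $G$ on a topological space $X$ is component effective if, for every $g\in G\setminus\{1_G\}$ and every connected component $X^\circ$ of $X$, there exists $x\in X^\circ$ such that $gx\ne x$. *)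

(* Defs.v *)
From HB Require Import structures.
From mathcomp Require Import all_boot all_order all_algebra.
From mathcomp Require Import all_classical all_reals all_analysis.

Set Implicit Arguments.
Unset Strict Implicit.
Unset Printing Implicit Defensive.

Import Order.TTheory GRing.Theory Num.Theory.
Import numFieldNormedType.Exports.

Local Open Scope classical_set_scope.
Local Open Scope ring_scope.

Section euclidean.
Context {R : realType} {m n : nat}.
Implicit Types (s : seq 'I_m) (f : 'rV[R]_m -> 'rV[R]_n).

Definition pderiv s f : 'rV[R]_m -> 'rV[R]_n :=
  foldr (fun i g => 'D_(delta_mx 0 i) g) f s.

(* [f] is C^oo on [U]; only meaningful for [U] open, as the partial derivatives
   are two-sided. *)
Definition Coo (U : set 'rV[R]_m) f :=
  forall s x, U x -> {for x, continuous (pderiv s f)} /\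
    forall i : 'I_m, derivable (pderiv s f) x (delta_mx 0 i).

End euclidean.

(* [cmap] and [cinv] are total functions: they are only relevant on [cdom] and
   on [ccod] (below) respectively. *)
Record chart (R : realType) (n : nat) (M : Type) := Chart {
  cdom : set M;
  cmap : M -> 'rV[R]_n;
  cinv : 'rV[R]_n -> M }.

Section charts.
Context {R : realType} {n : nat} {M : topologicalType}.
Implicit Types (c d : chart R n M) (A : set (chart R n M)).

Definition ccod c : set 'rV[R]_n := cmap c @` cdom c.

Definition is_chart c :=
  [/\ open (cdom c), open (ccod c),
      (forall x, cdom c x -> cinv c (cmap c x) = x),
      (forall x, cdom c x -> {for x, continuous (cmap c)}) &
      (forall v, ccod c v -> {for v, continuous (cinv c)})].

Definition smooth_compat c d :=
  Coo (cmap c @` (cdom c `&` cdom d)) (cmap d \o cinv c).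

Definition smooth_atlas A :=
  [/\ (forall c, A c -> is_chart c),
      (forall x, exists2 c, A c & cdom c x) &
      (forall c d, A c -> A d -> smooth_compat c d)].

End charts.

Definition euclidean_atlas (R : realType) (n : nat) :
    set (chart R n 'rV[R]_n) :=
  [set Chart setT id id].
Arguments euclidean_atlas : clear implicits.

Definition prod_chart (R : realType) (m n : nat) (M N : Type)
    (c : chart R m M) (d : chart R n N) : chart R (m + n) (M * N) :=
  Chart (cdom c `*` cdom d)
    (fun p => row_mx (cmap c p.1) (cmap d p.2))
    (fun v => (cinv c (lsubmx v), cinv d (rsubmx v))).

Definition prod_atlas (R : realType) (m n : nat) (M N : Type)
    (A : set (chart R m M)) (B : set (chart R n N)) :
    set (chart R (m + n) (M * N)) :=
  [set prod_chart c d | c in A & d in B].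

(* Smoothness of [f] on the open set [U], for the smooth structures generated
   by the atlases [A] and [B]. *)
Definition smooth_on (R : realType) (m n : nat) (M N : topologicalType)
    (A : set (chart R m M)) (B : set (chart R n N)) (U : set M) (f : M -> N) :=
  (forall x, U x -> {for x, continuous f}) /\
  forall c d, A c -> B d ->
    Coo (cmap c @` (U `&` cdom c `&` f @^-1` cdom d))
        (cmap d \o f \o cinv c).

HB.mixin Record isManifold (R : realType) (n : nat) M of Topological M := {
  atlas : set (chart R n M);
  manifold_hausdorff : hausdorff_space M;
  manifold_second_countable : @second_countable M;
  manifold_smooth_atlas : smooth_atlas atlas }.

#[short(type="manifoldType")]
HB.structure Definition Manifold (R : realType) (n : nat) :=
  { M of isManifold R n M & Topological M }.

Arguments atlas {R n} s.

HB.mixin Record isLieGroup (R : realType) (n : nat) G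
    of Manifold R n G & Group G := {
  lie_mul_smooth : smooth_on
    (prod_atlas (@atlas R n G) (@atlas R n G)) (@atlas R n G)
    setT (fun p : G * G => (p.1 * p.2)%g);
  lie_inv_smooth : smooth_on (@atlas R n G) (@atlas R n G)
    setT (fun g : G => (g^-1)%g) }.

#[short(type="lieGroupType")]
HB.structure Definition LieGroup (R : realType) (n : nat) :=
  { G of Manifold R n G & Group G & isLieGroup R n G }.

Definition left_action (G : groupType) (X : Type) (a : G -> X -> X) :=
  (forall x, a 1%g x = x) /\ (forall g h x, a (g * h)%g x = a g (a h x)).

Definition smooth_action (R : realType) (d n : nat)
    (G : lieGroupType R d) (M : manifoldType R n) (a : G -> M -> M) :=
  left_action a /\
  smooth_on (prod_atlas (atlas G) (atlas M)) (atlas M)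
    setT (fun p : G * M => a p.1 p.2).

Definition Stab (G X : Type) (a : G -> X -> X) (x : X) : set G :=
  [set g | a g x = x].

Definition components (X : topologicalType) : set (set X) :=
  range (connected_component [set: X]).
Arguments components : clear implicits.

Definition component_effective (G : groupType) (X : topologicalType)
    (a : G -> X -> X) :=
  forall g, g <> 1%g ->
  forall X0, components X X0 -> exists2 x, X0 x & a g x <> x.

Section frames.
Context {R : realType} {n : nat} {M : manifoldType R n}.
Implicit Types (phi psi : 'rV[R]_n -> M) (k : nat).

(* Local diffeomorphisms defined near 0 are represented by total functions,
   whose values away from 0 are irrelevant. *)
Definition local_diffeo phi :=
  exists (U : set 'rV[R]_n) (V : set M) (psi : M -> 'rV[R]_n),
    [/\ open_nbhs (0 : 'rV[R]_n) U, open V & [/\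
        set_fun U V phi, set_fun V U psi,
        {in U, cancel phi psi}, {in V, cancel psi phi} &
        smooth_on (euclidean_atlas R n) (atlas M) U phi /\
        smooth_on (atlas M) (euclidean_atlas R n) V psi]].

Definition same_jet k phi psi :=
  phi 0 = psi 0 /\
  forall c, atlas M c -> cdom c (phi 0) ->
  forall s : seq 'I_n, (size s <= k)%N ->
    pderiv s (cmap c \o phi) 0 = pderiv s (cmap c \o psi) 0.

(* The k-jet at 0 of a local diffeomorphism, as an equivalence class. *)
Definition jet k phi : set ('rV[R]_n -> M) :=
  [set psi | local_diffeo psi /\ same_jet k phi psi].

(* The total space of the k-th order frame bundle. *)
Definition frame_bundle k : set (set ('rV[R]_n -> M)) :=
  [set jet k phi | phi in local_diffeo].

(* If [x] is [jet k phi], all the sets in this union are equal to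
   [jet k (a g \o phi)]. *)
Definition prolong (G : Type) (a : G -> M -> M) k (g : G)
    (x : set ('rV[R]_n -> M)) : set ('rV[R]_n -> M) :=
  \bigcup_(phi in x) jet k (a g \o phi).

End frames.

Arguments frame_bundle {R n} M k.

(* Main.v *)
(** Let [K] be a compact subgroup of the stabilizer of a frame at [p]. Each [k] in
    [K] fixes [p] and has identity differential there, so in a chart [c], with
    [h_k := c o k o c^-1] and uniformly over the compact set [K],
    [|h_k u - h_k v - (u - v)| <= |u - v| / 2] near [c p]. Applied to [k ^ j] and
    the points [h_k u], [u], this says that the orbit [h_(k ^ j) u] moves at each
    step by [h_k u - u] up to half its size; since it stays bounded, [h_k u = u].
    Hence [K] is trivial near [p]. The set of points near which [K] is trivial is
    open, and it is closed because at a limit point [K] again fixes the point to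
    first order. It thus contains the component of [p], and component
    effectiveness gives [K = 1]. *)

Require Import Defs.
From HB Require Import structures.
From mathcomp Require Import all_boot all_order all_algebra.
From mathcomp Require Import all_classical all_reals all_analysis.
From mathcomp Require Import lra.
Set Implicit Arguments.
Unset Strict Implicit.
Unset Printing Implicit Defensive.
Import Order.TTheory GRing.Theory Num.Theory.
Import numFieldNormedType.Exports.
Local Open Scope classical_set_scope.
Local Open Scope ring_scope.

(** * The sup norm on row vectors *)

Section row_norm.
Context {R : realType} {n : nat}.
Implicit Type u : 'rV[R]_n.

Lemma row_norm_coord u j : `|u 0 j| <= `|u|.
Proof.
by rewrite [leRHS]/Num.Def.normr/= mx_normrE; exact: (le_bigmax _ _ (ord0, j)).
Qed.

Lemma row_norm_le u e : 0 <= e -> (forall j, `|u 0 j| <= e) -> `|u| <= e.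
Proof.
move=> e0 ue; rewrite [leLHS]/Num.Def.normr/= mx_normrE bigmax_le//= => -[i j] _.
by rewrite /= ord1.
Qed.

Lemma row_norm_lt u e : 0 < e -> (forall j, `|u 0 j| < e) -> `|u| < e.
Proof.
move=> e0 ue; rewrite [ltLHS]/Num.Def.normr/= mx_normrE bigmax_lt//= => -[i j] _.
by rewrite /= ord1.
Qed.

End row_norm.

(** * Mean value inequalities and differentiability from partial derivatives *)

Section mean_value.
Context {R : realType}.

(** The two difference quotients are the same function of [h], so derivability and the derivative
    both transfer by rewriting, with no chain rule. *)
Lemma line_quotient {V W : normedModType R} (f : V -> W) w v (s : R) :
  (fun h : R => h^-1 *: (((fun r : R => f (w + r *: v)) \o shift s) (h *: 1)
     - f (w + s *: v))) =
  (fun h : R => h^-1 *: ((f \o shift (w + s *: v)) (h *: v) - f (w + s *: v))).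
Proof.
by apply/funext => h; rewrite /= [h *: 1]mulr1 scalerDl addrCA.
Qed.

Lemma derivable_line {V W : normedModType R} (f : V -> W) w v (s : R) :
  derivable (fun r : R => f (w + r *: v)) s 1 = derivable f (w + s *: v) v.
Proof. by rewrite /derivable line_quotient. Qed.

Lemma derive_line {V W : normedModType R} (f : V -> W) w v (s : R) :
  'D_1 (fun r : R => f (w + r *: v)) s = 'D_v f (w + s *: v).
Proof. by rewrite /derive line_quotient. Qed.

(** The one-variable mean value theorem is applied to each coordinate. The intermediate point varies
    with the coordinate, which is harmless for the sup norm. *)
Lemma line_mean_value_le {V : normedModType R} {n} (f : V -> 'rV[R]_n) w v a e
    (s t : R) : 0 <= e -> s <= t ->
  (forall r, s <= r <= t -> derivable f (w + r *: v) v /\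
    `|'D_v f (w + r *: v) - a| <= e) ->
  `|f (w + t *: v) - f (w + s *: v) - (t - s) *: a| <= e * (t - s).
Proof.
move=> e0 st df; have ts0 : 0 <= t - s by rewrite subr_ge0.
apply: row_norm_le => [|j]; first exact: mulr_ge0.
pose g r := f (w + r *: v) 0 j.
have dg r : s <= r <= t -> is_derive r 1 g ('D_v f (w + r *: v) 0 j).
  move=> /df[+ _]; rewrite -derivable_line => dfr; split.
    by have /derivable_mxP := dfr; exact.
  by rewrite -derive_line (derive_mx dfr) mxE.
have [r||r] := @MVT_segment _ g (fun r => 'D_v f (w + r *: v) 0 j) s t st.
- by rewrite in_itv/= => /andP[/ltW sr /ltW rt]; apply: dg; rewrite sr.
- apply: derivable_within_continuous => x; rewrite in_itv/= => xst.
  exact: (@ex_derive _ _ _ _ _ _ _ (dg _ xst)).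
- rewrite in_itv/= => rst gE; rewrite !mxE -/(g t) -/(g s) gE mulrC -mulrBr normrM.
  rewrite (ger0_norm ts0) mulrC ler_wpM2r//.
  by apply: le_trans (df _ rst).2; apply: le_trans (row_norm_coord _ j); rewrite !mxE.
Qed.


Lemma axis_mean_value_le {V : normedModType R} {n} (f : V -> 'rV[R]_n) w v a e
    (s t : R) : 0 <= e ->
  (forall r, (s <= r <= t) || (t <= r <= s) -> derivable f (w + r *: v) v /\
    `|'D_v f (w + r *: v) - a| <= e) ->
  `|f (w + t *: v) - f (w + s *: v) - (t - s) *: a| <= e * `|t - s|.
Proof.
move=> e0 df; have [st|/ltW ts] := leP s t.
  rewrite ger0_norm ?subr_ge0//; apply: line_mean_value_le => // r rst.
  by apply: df; rewrite rst.
rewrite -scaleNr opprB -normrN opprD opprB [`|t - s|]distrC ger0_norm ?subr_ge0//.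
by apply: line_mean_value_le => // r rts; apply: df; rewrite rts orbT.
Qed.

(** A move along one axis involves one partial derivative and costs at most [e * |u - v|]; [m] such
    moves lead from [v] to [u]. The ball is a cube, so it contains every intermediate point. *)
Lemma ball_mean_value_le {m n} (f : 'rV[R]_m -> 'rV[R]_n)
    (A : {linear 'rV[R]_m -> 'rV[R]_n}) (x : 'rV[R]_m) (d e : R) : 0 <= e ->
  (forall w, `|w - x| < d -> forall i, derivable f w (delta_mx 0 i) /\
    `|'D_(delta_mx 0 i) f w - A (delta_mx 0 i)| <= e) ->
  forall u v, `|u - x| < d -> `|v - x| < d ->
  `|f u - f v - A (u - v)| <= m%:R * e * `|u - v|.
Proof.
move=> e0 df u v ud vd.
have d0 : 0 < d by exact: le_lt_trans ud.
(* [w] runs from [v] to [u] replacing one coordinate at a time. *)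
pose w k : 'rV[R]_m := \row_i (if (i < k)%N then u 0 i else v 0 i).
have w0 : w 0%N = v by apply/rowP => i; rewrite mxE.
have wm : w m = u by apply/rowP => i; rewrite mxE ltn_ord.
have coordx (y : 'rV[R]_m) i : `|y - x| < d -> `|y 0 i - x 0 i| < d.
  by apply: le_lt_trans; have := row_norm_coord (y - x) i; rewrite !mxE.
suff H k : (k <= m)%N ->
    `|f (w k) - f v - A (w k - v)| <= k%:R * e * `|u - v|.
  by have := H m (leqnn m); rewrite wm.
elim: k => [_|k IH km]; first by rewrite w0 !subrr linear0 subr0 normr0 !mul0r.
(* [b] is [w k] with coordinate [i] cleared: [w k] and [w k.+1] lie on one axis line through [b], at
   parameters [v 0 i] and [u 0 i]. *)
pose i := Ordinal km; pose b := w k - v 0 i *: delta_mx 0 i.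
have wk : w k = b + v 0 i *: delta_mx 0 i by rewrite subrK.
have wk1 : w k.+1 = b + u 0 i *: delta_mx 0 i.
  apply/rowP => j; rewrite !mxE ltnS eqxx/=.
  have [->|ji] := eqVneq j i; first by rewrite leqnn ltnn mulr1 subrr add0r mulr1.
  rewrite !mulr0 subr0 addr0 leq_eqVlt; case: eqP => //= jk.
  by move/eqP: ji; case; exact: val_inj.
have := @axis_mean_value_le _ _ f b (delta_mx 0 i) (A (delta_mx 0 i)) e
  (v 0 i) (u 0 i) e0.
rewrite -wk -wk1 => /(_ _) step.
have -> : f (w k.+1) - f v - A (w k.+1 - v) =
    (f (w k.+1) - f (w k) - (u 0 i - v 0 i) *: A (delta_mx 0 i)) +
    (f (w k) - f v - A (w k - v)).
  have -> : w k.+1 - v = (u 0 i - v 0 i) *: delta_mx 0 i + (w k - v).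
    rewrite wk1 wk scalerBl; set p := v 0 i *: _; set q := u 0 i *: _.
    by rewrite [RHS]addrA [q - p + _]addrC addrA [b + p + q]addrAC addrK.
  rewrite linearD linearZ opprD; set p := _ *: _; set q := A _.
  by rewrite [RHS]addrACA subrKA.
rewrite (le_trans (ler_normD _ _))// -natr1 mulrDl mulrDl mul1r addrC lerD//.
  exact/IH/ltnW.
apply: (@le_trans _ _ (e * `|u 0 i - v 0 i|)).
  apply: step => r rvu; apply: df; apply: row_norm_lt => // j.
  rewrite !mxE eqxx/=; have [->|ji] := eqVneq j i.
    rewrite ltnn !mulr1 subrr add0r; have := coordx _ i ud; have := coordx _ i vd.
    rewrite !ltr_norml => /andP[? ?] /andP[? ?]; apply/andP.
    by case/orP: rvu => /andP[? ?]; split; lra.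
  by rewrite !mulr0 subr0 addr0; case: ifP => _; exact: coordx.
by rewrite ler_wpM2l//; have := row_norm_coord (u - v) i; rewrite !mxE.
Qed.

Lemma linear_row_continuous {m n} (A : {linear 'rV[R]_m -> 'rV[R]_n}) :
  continuous A.
Proof.
apply/linear_bounded_continuous/linear_boundedP.
near=> r => x; rewrite [in leLHS](row_sum_delta x) linear_sum.
apply: (@le_trans _ _ (\sum_i `|x| * `|A (delta_mx 0 i)|)).
  apply: le_trans (ler_norm_sum _ _ _) _; apply: ler_sum => i _.
  by rewrite linearZ normrZ ler_wpM2r// row_norm_coord.
by rewrite -mulr_sumr mulrC ler_wpM2r.
Unshelve. all: by end_near. Qed.

(** On small cubes around [x], [ball_mean_value_le] with the linear map [A] of partial derivatives
    at [x] gives the first-order expansion. *)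
Lemma differentiable_partials {m n} (f : 'rV[R]_m -> 'rV[R]_n) x :
  (\forall y \near x, forall i, derivable f y (delta_mx 0 i)) ->
  (forall i, {for x, continuous ('D_(delta_mx 0 i) f)}) ->
  differentiable f x.
Proof.
move=> df cf.
pose J := \matrix_(i < m, j < n) 'D_(delta_mx 0 i) f x 0 j.
pose A : {linear 'rV[R]_m -> 'rV[R]_n} := mulmxr J.
have Ae i : A (delta_mx 0 i) = 'D_(delta_mx 0 i) f x.
  by rewrite /A/= -rowE; apply/rowP => j; rewrite !mxE.
have cA : continuous A by exact: linear_row_continuous.
have fA : f \o shift x = cst (f x) + A +o_0 id.
  apply/eqaddoP => _/posnumP[e].
  (* Chosen so that [m%:R * e' <= e]; the successor keeps the denominator nonzero when [m = 0]. *)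
  pose e' : R := e%:num / m.+1%:R.
  have e'0 : 0 < e' by rewrite divr_gt0.
  have : \forall y \near x, forall i, derivable f y (delta_mx 0 i) /\
      `|'D_(delta_mx 0 i) f y - A (delta_mx 0 i)| <= e'.
    near=> y => i; split; first by move: i; near: y.
    rewrite Ae distrC; move: i; near: y; apply: filter_forall => i.
    by have /cvgrPdist_le := cf i; exact.
  rewrite -nbhs_nearE => /nbhs_ballP[d /= d0]; rewrite mx_norm_ball => dP.
  have {}dP w : `|w - x| < d -> forall i, derivable f w (delta_mx 0 i) /\
      `|'D_(delta_mx 0 i) f w - A (delta_mx 0 i)| <= e'.
    by rewrite distrC; exact: dP.
  have H := ball_mean_value_le (ltW e'0) dP.
  near=> h.
  have := H (h + x) x; rewrite subrr normr0 addrK => {}H.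
  rewrite [X in `|X|](_ : _ = f (h + x) - f x - A h); last first.
    by rewrite !fctE /= opprD addrA.
  apply: le_trans (H _ d0) _.
  - by near: h; have := @nbhs0_lt R 'rV[R]_m _ d0; apply.
  - rewrite ler_wpM2r// /e' mulrCA ler_piMr// ler_pdivrMr// mul1r.
    by rewrite ler_nat.
by apply/diff_locallyP; rewrite (diff_unique cA fA).
Unshelve. all: by end_near. Qed.

End mean_value.

(** After [N] steps the displacement is [v *+ N] up to half its norm, hence at least [N |v| / 2],
    which is unbounded unless [v = 0]. *)
Lemma bounded_drift_eq0 {R : realType} {V : normedModType R} (U : nat -> V)
    (v : V) (C : R) :
  (forall j, `|U j.+1 - U j - v| <= 2^-1 * `|v|) ->
  (forall j, `|U j - U 0%N| <= C) -> v = 0.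
Proof.
move=> Uv UC; apply/eqP; apply: contraT; rewrite -normr_gt0 => v0.
have drift N : `|U N - U 0%N - v *+ N| <= N%:R * (2^-1 * `|v|).
  elim: N => [|N IH]; first by rewrite mulr0n subrr subr0 normr0 mul0r.
  have -> : U N.+1 - U 0%N - v *+ N.+1 =
      (U N.+1 - U N - v) + (U N - U 0%N - v *+ N).
    by rewrite mulrS opprD [RHS]addrACA subrKA.
  apply: le_trans (ler_normD _ _) _.
  by rewrite -natr1 [leRHS]mulrDl mul1r [leRHS]addrC lerD.
have bound N : N%:R * (2^-1 * `|v|) <= C.
  have : `|v *+ N| <= `|U N - U 0%N| + `|U N - U 0%N - v *+ N|.
    by rewrite -{1}[v *+ N](subKr (U N - U 0%N)) (le_trans (ler_normB _ _)).
  move: (UC N) (drift N); rewrite mulrCA normrMn -[`|v| *+ N]mulr_natl.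
  by move: `|U N - U 0%N - v *+ N| `|U N - U 0%N| (N%:R * `|v|) => x y z; lra.
have C0 := le_trans (normr_ge0 _) (UC 0%N).
have v2 : 0 < 2^-1 * `|v| by rewrite mulr_gt0.
have := archi_boundP (divr_ge0 C0 (ltW v2)).
by rewrite ltr_pdivrMr// => /lt_le_trans /(_ (bound _)); rewrite ltxx.
Qed.

Lemma derive_comp {R : realType} {U V W : normedModType R} (f : U -> V)
    (g : V -> W) x v y : f x = y -> differentiable f x -> differentiable g y ->
  'D_v (g \o f) x = 'd g y ('d f x v).
Proof.
move=> <- df dg; rewrite (deriveE v (differentiable_comp df dg)).
by rewrite (diff_comp df dg).
Qed.

(** The empty word gives the partial derivatives near [x], and the word [[:: i]] their continuity at
    [x]. *)
Lemma Coo_differentiable {R : realType} {m n} (U : set 'rV[R]_m)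
    (f : 'rV[R]_m -> 'rV[R]_n) x : nbhs x U -> Coo U f -> differentiable f x.
Proof.
move=> xU fU; apply: differentiable_partials => [|i].
  by apply: filterS xU => y Uy i; exact: (fU [::] y Uy).2.
exact: (fU [:: i] x (nbhs_singleton xU)).1.
Qed.

(** * Charts and local diffeomorphisms *)

Section chart_neighborhoods.
Context {R : realType} {n : nat} {M : topologicalType} (c : chart R n M).
Hypothesis chart_c : is_chart c.

Lemma chart_near p (P : set M) : cdom c p -> nbhs p P ->
  \forall u \near cmap c p,
    [/\ cdom c (cinv c u), cmap c (cinv c u) = u & P (cinv c u)].
Proof.
case: chart_c => oD oC cK cc ic cp pP.
have Cp : ccod c (cmap c p) by exists p.
near=> u.
have [y cy yu] : ccod c u by near: u; exact: open_nbhs_nbhs.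
split; [by rewrite -yu cK|by rewrite -yu cK|].
by near: u; apply: (ic _ Cp); rewrite cK.
Unshelve. all: by end_near. Qed.

Lemma chart_image_nbhs p (P : set M) : cdom c p -> nbhs p P ->
  nbhs (cmap c p) (cmap c @` (P `&` cdom c)).
Proof.
move=> cp pP; apply: filterS (chart_near cp pP) => u [du uK Pu].
by exists (cinv c u).
Qed.

End chart_neighborhoods.

Lemma atlas_is_chart {R : realType} {n} {M : manifoldType R n} (c : chart R n M) :
  atlas M c -> is_chart c.
Proof. by case: (@manifold_smooth_atlas R n M) => H _ _; exact: H. Qed.

Section local_diffeomorphisms.
Context {R : realType} {n : nat} {M : manifoldType R n}.
Implicit Types (c : chart R n M) (phi : 'rV[R]_n -> M).

Lemma local_diffeo_continuous phi : local_diffeo phi ->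
  {for 0, continuous phi}.
Proof.
by move=> [U [V [psi [[_ U0] _ [_ _ _ _ [[cphi _] _]]]]]]; exact: cphi.
Qed.

Lemma local_diffeo_differentiable phi c : local_diffeo phi ->
  atlas M c -> cdom c (phi 0) -> differentiable (cmap c \o phi) 0.
Proof.
move=> lphi Ac c0; have cphi := local_diffeo_continuous lphi.
move: lphi => [U [V [psi [[oU U0] _ [_ _ _ _ [[_ sphi] _]]]]]].
have := sphi _ c (erefl _ : euclidean_atlas R n (Chart setT id id)) Ac.
apply: Coo_differentiable; rewrite image_id /=.
have [oD _ _ _ _] := atlas_is_chart Ac.
apply: filterI; first by rewrite setIT; exact: open_nbhs_nbhs.
by apply: cphi; exact: open_nbhs_nbhs.
Qed.

(** Near [cmap c (phi 0)], [psi \o cinv c] is a right inverse of [cmap c \o phi]; by the chain rule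
    its differential is a right inverse of the differential. *)
Lemma local_diffeo_surjective phi c : local_diffeo phi ->
  atlas M c -> cdom c (phi 0) ->
  forall v, exists w, 'd (cmap c \o phi) 0 w = v.
Proof.
move=> lphi Ac c0 v; have dphi := local_diffeo_differentiable lphi Ac c0.
move: lphi => [U [V [psi [[oU U0] oV [UV VU UK VK [_ [_ spsi]]]]]]].
have chc := atlas_is_chart Ac; have [oD _ cK _ _] := chc.
have V0 : V (phi 0) by exact: UV.
have psiE : (psi \o cinv c) (cmap c (phi 0)) = 0.
  by rewrite /= cK// UK// inE.
have dpsi : differentiable (psi \o cinv c) (cmap c (phi 0)).
  have := spsi c _ Ac (erefl _ : euclidean_atlas R n (Chart setT id id)).
  apply: Coo_differentiable; rewrite /= preimage_setT setIT.
  exact/chart_image_nbhs/open_nbhs_nbhs.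
exists ('d (psi \o cinv c) (cmap c (phi 0)) v).
rewrite -(derive_comp v psiE dpsi dphi).
rewrite (@near_eq_derive _ _ _ _ id) ?derive_id//.
have := chart_near chc c0 (open_nbhs_nbhs (conj oV V0)).
by apply: filterS => u [_ uK Vu]; rewrite /= VK ?inE.
Qed.

End local_diffeomorphisms.

Lemma cvg_row_mx {R : realType} {T : Type} (F : set_system T) {FF : Filter F}
    {m n} (f : T -> 'rV[R]_m) (g : T -> 'rV[R]_n) (x : 'rV[R]_m) (y : 'rV[R]_n) :
  f @ F --> x -> g @ F --> y -> (fun t => row_mx (f t) (g t)) @ F --> row_mx x y.
Proof.
move=> /cvgrPdist_lt fx /cvgrPdist_lt gy; apply/cvgrPdist_lt => e e0.
near=> t; rewrite opp_row_mx add_row_mx; apply: row_norm_lt => // j.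
rewrite mxE; case: splitP => i _; apply: le_lt_trans (row_norm_coord _ i) _.
  by near: t; exact: fx.
by near: t; exact: gy.
Unshelve. all: by end_near. Qed.

(** A move along the second factor leaves the first block fixed, so partial derivatives in these
    directions are taken with the group element frozen. *)
Lemma add_scale_delta_row_mx {R : realType} {m n} (s : R) (x : 'rV[R]_m) y
    (i : 'I_n) :
  s *: delta_mx 0 (rshift m i) + row_mx x y = row_mx x (s *: delta_mx 0 i + y).
Proof.
have -> : delta_mx 0 (rshift m i) = row_mx 0 (delta_mx 0 i) :> 'rV[R]_(m + n).
  apply/rowP => j; rewrite !mxE eqxx -val_eqE /=.
  case: splitP => k ->; rewrite !mxE ?eqxx/=.
    by rewrite ltn_eqF// (leq_trans (ltn_ord k))// leq_addr.
  by rewrite eqn_add2l.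
by rewrite scale_row_mx add_row_mx scaler0 add0r.
Qed.

(** * Smooth actions in coordinates *)

Section smooth_actions.
Context {R : realType} {d n : nat} {G : lieGroupType R d}.
Context {M : manifoldType R n} (a : G -> M -> M).
Hypothesis smooth_a : smooth_action a.
Implicit Types (c : chart R n M) (g k : G) (p y : M).

Let act1 y : a 1%g y = y. Proof. exact: smooth_a.1.1. Qed.
Let actM g k y : a (g * k)%g y = a g (a k y). Proof. exact: smooth_a.1.2. Qed.

(** The map [h_g] in the notation above. It describes [a g] only at coordinates of points [y] with
    both [y] and [a g y] in [cdom c]. *)
Definition local_rep c g := cmap c \o a g \o cinv c.

Lemma local_rep_chart c g y : atlas M c -> cdom c y ->
  local_rep c g (cmap c y) = cmap c (a g y).
Proof. by move=> /atlas_is_chart[_ _ cK _ _] cy; rewrite /local_rep/= cK. Qed.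

Lemma action_continuous k p :
  (fun gy : G * M => a gy.1 gy.2) @ (k, p) --> a k p.
Proof. exact: (smooth_a.2.1 (k, p) I). Qed.

Lemma action_near k p (P : set M) : nbhs (a k p) P ->
  \forall gy \near (k, p), P (a gy.1 gy.2).
Proof. exact: action_continuous. Qed.

(** The group variable gets coordinates too, so that smoothness of the action controls the partial
    derivatives of [local_rep c g] jointly in [g] and the point. *)
Definition joint_rep (b : chart R d G) c :=
  cmap c \o (fun gy : G * M => a gy.1 gy.2) \o cinv (prod_chart b c).

Lemma joint_rep_quotient b c g (u : 'rV[R]_n) i :
  atlas G b -> cdom b g ->
  (fun h : R => h^-1 *: ((local_rep c g \o shift u) (h *: delta_mx 0 i)
     - local_rep c g u)) =
  (fun h : R => h^-1 *: ((joint_rep b c \o shift (row_mx (cmap b g) u))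
     (h *: delta_mx 0 (rshift d i)) - joint_rep b c (row_mx (cmap b g) u))).
Proof.
move=> /atlas_is_chart[_ _ bK _ _] bg; apply/funext => h.
rewrite /local_rep/joint_rep/= add_scale_delta_row_mx.
by rewrite !row_mxKl !row_mxKr bK.
Qed.

Lemma local_rep_partials b c g y : atlas G b -> atlas M c ->
  cdom b g -> cdom c y -> cdom c (a g y) -> forall i,
  [/\ derivable (local_rep c g) (cmap c y) (delta_mx 0 i),
      'D_(delta_mx 0 i) (local_rep c g) (cmap c y) =
      'D_(delta_mx 0 (rshift d i)) (joint_rep b c)
        (row_mx (cmap b g) (cmap c y)) &
      {for row_mx (cmap b g) (cmap c y),
        continuous ('D_(delta_mx 0 (rshift d i)) (joint_rep b c))}].
Proof.
move=> Ab Ac bg cy cgy i.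
have Abc : prod_atlas (atlas G) (atlas M) (prod_chart b c).
  by exists b => //; exists c.
have Coo_bc := smooth_a.2.2 _ c Abc Ac.
have bcgy : [set cmap (prod_chart b c) z | z in setT `&` cdom (prod_chart b c) `&`
   (fun gy : G * M => a gy.1 gy.2) @^-1` cdom c] (row_mx (cmap b g) (cmap c y)).
  by exists (g, y).
split; last exact: (Coo_bc [:: rshift d i] _ bcgy).1.
  by rewrite /derivable (joint_rep_quotient c (cmap c y) i Ab bg);
     exact: (Coo_bc [::] _ bcgy).2.
by rewrite /derive (joint_rep_quotient c (cmap c y) i Ab bg).
Qed.

Section at_a_point.
Variables (c : chart R n M) (k : G) (p : M).
Hypotheses (Ac : atlas M c) (cp : cdom c p) (ckp : cdom c (a k p)).

Lemma near_local_rep_derivable : \forall gy \near (k, p),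
  [/\ cdom c gy.2, cdom c (a gy.1 gy.2) & forall i,
    derivable (local_rep c gy.1) (cmap c gy.2) (delta_mx 0 i)].
Proof.
have [_ Gcov _] := @manifold_smooth_atlas R d G.
have [b Ab bk] := Gcov k.
have [oDb _ _ _ _] := atlas_is_chart Ab; have [oD _ _ _ _] := atlas_is_chart Ac.
near=> gy.
have bg : cdom b gy.1.
  by near: gy; apply: cvg_fst; exact: open_nbhs_nbhs.
have cy : cdom c gy.2.
  by near: gy; apply: cvg_snd; exact: open_nbhs_nbhs.
have cgy : cdom c (a gy.1 gy.2).
  by near: gy; apply: action_near; exact: open_nbhs_nbhs.
by split=> // i; have [] := local_rep_partials Ab Ac bg cy cgy i.
Unshelve. all: by end_near. Qed.

(** Near [(k, p)] these are partial derivatives of [joint_rep] composed with continuous charts.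
    Convergence in the pair is what makes uniformity over compact sets of [k] possible. *)
Lemma local_rep_partial_cvg i :
  'D_(delta_mx 0 i) (local_rep c gy.1) (cmap c gy.2) @[gy --> (k, p)] -->
  'D_(delta_mx 0 i) (local_rep c k) (cmap c p).
Proof.
have [_ Gcov _] := @manifold_smooth_atlas R d G.
have [b Ab bk] := Gcov k.
have [oDb _ _ cb _] := atlas_is_chart Ab.
have [oD _ _ cc _] := atlas_is_chart Ac.
have [_ -> cD] := local_rep_partials Ab Ac bk cp ckp i.
have brow : (fun gy : G * M => row_mx (cmap b gy.1) (cmap c gy.2)) @ (k, p) -->
    row_mx (cmap b k) (cmap c p).
  apply: cvg_row_mx.
    by apply: (@cvg_comp _ _ _ fst (cmap b)) (cb _ bk); exact: cvg_fst.
  by apply: (@cvg_comp _ _ _ snd (cmap c)) (cc _ cp); exact: cvg_snd.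
apply: cvg_trans (cvg_comp _ _ brow cD).
apply: near_eq_cvg; near=> gy => /=.
have bg : cdom b gy.1.
  by near: gy; apply: cvg_fst; exact: open_nbhs_nbhs.
have cy : cdom c gy.2.
  by near: gy; apply: cvg_snd; exact: open_nbhs_nbhs.
have cgy : cdom c (a gy.1 gy.2).
  by near: gy; apply: action_near; exact: open_nbhs_nbhs.
by have [] := local_rep_partials Ab Ac bg cy cgy i.
Unshelve. all: by end_near. Qed.

(** Restricting the joint statements to the slice of pairs [(k, cinv c u)] gives the hypotheses of
    [differentiable_partials]. *)
Lemma local_rep_differentiable : differentiable (local_rep c k) (cmap c p).
Proof.
have chc := atlas_is_chart Ac; have [_ _ cK _ ic] := chc.
have kinv : (fun u => (k, cinv c u)) @ cmap c p --> (k, p).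
  have invp : cinv c u @[u --> cmap c p] --> p.
    by rewrite -{2}(cK _ cp); apply: ic; exists p.
  exact: (cvg_pair (cvg_cst k) invp).
have nid : \forall u \near cmap c p, cmap c (cinv c u) = u.
  apply: filterS (chart_near chc cp (_ : nbhs p setT)); last exact: filterT.
  by move=> u [].
apply: differentiable_partials => [|i].
  near=> u => i.
  have uK : cmap c (cinv c u) = u by near: u; exact: nid.
  have [_ _ /(_ i)] : [/\ cdom c (k, cinv c u).2,
    cdom c (a (k, cinv c u).1 (k, cinv c u).2) & forall i,
      derivable (local_rep c (k, cinv c u).1) (cmap c (k, cinv c u).2)
      (delta_mx 0 i)].
    near: u; exact: (kinv _ near_local_rep_derivable).
  by rewrite /= uK.
have D_near : {near cmap c p,
    (fun u => 'D_(delta_mx 0 i) (local_rep c k) (cmap c (cinv c u))) =1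
    'D_(delta_mx 0 i) (local_rep c k)}.
  by apply: filterS nid => u uK /=; rewrite uK.
have D_cvg := cvg_comp _ _ kinv (@local_rep_partial_cvg i).
apply: cvg_trans D_cvg; exact: (near_eq_cvg D_near).
Unshelve. all: by end_near. Qed.

End at_a_point.

(** * Compact groups acting trivially to first order *)

Variable K : set G.
Hypotheses (groupK : group_closed (mem K)) (compactK : compact K).

Let groupX k j : K k -> K (k ^+ j)%g.
Proof.
have [/set_mem K1 divK] := groupK.
have {}divK g h : K g -> K h -> K (g / h)%g.
  by move=> Kg Kh; apply/set_mem/divK; exact/mem_set.
have mulK g h : K g -> K h -> K (g * h)%g.
  by move=> Kg Kh; have := divK _ _ Kg (divK _ _ K1 Kh); rewrite div1g invgK.
by move=> Kk; elim: j => [|j IH]; rewrite ?expg0// expgS; exact: mulK.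
Qed.

(** As a set, the interior of the set of points fixed by all of [K]. *)
Definition trivial_near p := \forall y \near p, forall k, K k -> a k y = y.

Lemma tangent_identity_trivial_near c p : atlas M c -> cdom c p ->
  (forall k, K k -> a k p = p) ->
  (forall k i, K k ->
    'D_(delta_mx 0 i) (local_rep c k) (cmap c p) = delta_mx 0 i) ->
  trivial_near p.
Proof.
move=> Ac cp fixp idp; have chc := atlas_is_chart Ac.
have [oD _ cK cc _] := chc.
(* Chosen so that [n%:R * e <= 2^-1], also when [n = 0]. *)
pose e : R := (2 * n.+1%:R)^-1.
have e0 : 0 < e by rewrite invr_gt0 mulr_gt0.
pose P y k := [/\ cdom c y, cdom c (a k y) & forall i,
  derivable (local_rep c k) (cmap c y) (delta_mx 0 i) /\
  `|'D_(delta_mx 0 i) (local_rep c k) (cmap c y) - delta_mx 0 i| <= e].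
(* Each [k] in [K] has a neighborhood of [(k, p)] on which [P] holds; compactness of [K] yields one
   neighborhood of [p] valid for all [k]. *)
have nearP : \forall y \near p, K `<=` P y.
  move/compact_near_coveringP: compactK; apply => k Kk.
  have ckp : cdom c (a k p) by rewrite fixp.
  have nD : \forall gy \near (k, p), forall i,
      `|'D_(delta_mx 0 i) (local_rep c gy.1) (cmap c gy.2) - delta_mx 0 i| <= e.
    apply: (@filter_forall _ _ _ _ (nbhs_filter (k, p))) => i.
    have /cvgrPdist_le/(_ e e0) := @local_rep_partial_cvg _ _ _ Ac cp ckp i.
    by apply: filterS => gy; rewrite (idp k i Kk) distrC.
  near=> gy.
  have [cy cgy dy] : [/\ cdom c gy.2, cdom c (a gy.1 gy.2) & forall i,
    derivable (local_rep c gy.1) (cmap c gy.2) (delta_mx 0 i)].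
    by near: gy; exact: near_local_rep_derivable.
  by split=> // i; split=> //; move: i; near: gy.
have [r /= r0 rP] : exists2 r : R, 0 < r & forall u, `|u - cmap c p| < r ->
    [/\ cdom c (cinv c u), cmap c (cinv c u) = u & K `<=` P (cinv c u)].
  have /nbhs_ballP[r /= r0] := chart_near chc cp nearP.
  rewrite mx_norm_ball => rP; exists r => // u ur; apply: rP.
  by rewrite /ball_/= distrC.
(* [ball_mean_value_le] with the identity as linear map: [h_k] minus the identity is Lipschitz with
   constant one half. *)
have almost_translation k u v : K k -> `|u - cmap c p| < r ->
    `|v - cmap c p| < r ->
    `|local_rep c k u - local_rep c k v - (u - v)| <= 2^-1 * `|u - v|.
  move=> Kk ur vr.
  apply: (@le_trans _ _ (n%:R * e * `|u - v|)).
    apply: (@ball_mean_value_le _ _ _ _ idfun _ _ _ (ltW e0) _ _ _ ur vr) => w wr i.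
    by have [_ wK /(_ k Kk)[_ _ /(_ i)]] := rP w wr; rewrite wK.
  rewrite ler_wpM2r// /e invfM mulrCA ler_piMr ?invr_ge0//.
  by rewrite ler_pdivrMr// mul1r ler_nat.
have rep_p k : K k -> local_rep c k (cmap c p) = cmap c p.
  by move=> Kk; rewrite local_rep_chart// fixp.
(* Comparison with the fixed point [cmap c p] gives a distance at most [3/2] of the original one. As
   this holds for every element of [K], it applies to all powers of [k] at once, without iterating
   the estimate. *)
have rep_bound k u : K k -> `|u - cmap c p| < r / 2 ->
    `|local_rep c k u - cmap c p| < r.
  move=> Kk ur; have ur' : `|u - cmap c p| < r by lra.
  have pr : `|cmap c p - cmap c p| < r by rewrite subrr normr0.
  have := almost_translation k _ _ Kk ur' pr; rewrite rep_p//.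
  have := ler_normD (local_rep c k u - cmap c p - (u - cmap c p)) (u - cmap c p).
  rewrite subrK; lra.
have fixu k u : K k -> `|u - cmap c p| < r / 2 -> local_rep c k u = u.
  move=> Kk ur; have ur' : `|u - cmap c p| < r by lra.
  have [cu uK Pu] := rP u ur'.
  have rep0 : local_rep c (k ^+ 0)%g u = u by rewrite /local_rep/= expg0 act1.
  have repS j : local_rep c (k ^+ j.+1)%g u = local_rep c (k ^+ j)%g (local_rep c k u).
    rewrite /local_rep/= expgSr actM cK//.
    by have [] := Pu k Kk.
  apply/eqP; rewrite -subr_eq0; apply/eqP.
  (* The drift is [h_k u - u]. The bound [2 * r] comes from the triangle inequality through
     [cmap c p], with [r] for the orbit and [r / 2] for [u]. *)
  apply: (@bounded_drift_eq0 _ _ (fun j => local_rep c (k ^+ j)%g u) _ (2 * r)).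
    move=> j; rewrite repS; apply: almost_translation => //; first exact: groupX.
    exact: rep_bound.
  move=> j; rewrite rep0; have := rep_bound _ _ (groupX j Kk) ur.
  have := ler_distD (cmap c p) (local_rep c (k ^+ j)%g u) u.
  rewrite [`|cmap c p - u|]distrC; lra.
rewrite /trivial_near; near=> y => k Kk.
have yr : `|cmap c y - cmap c p| < r / 2.
  rewrite distrC; near: y; have /cvgrPdist_lt := cc _ cp.
  by apply; rewrite divr_gt0.
have yr' : `|cmap c y - cmap c p| < r by lra.
have cy : cdom c y by near: y; exact: open_nbhs_nbhs.
(* Both [y] and [a k y] lie in [cdom c], where equal coordinates mean equal points. *)
have [_ _ /(_ k Kk)] := rP _ yr'; rewrite cK// => -[_ cky _].
by rewrite -[LHS]cK// -[RHS]cK// -(fixu _ _ Kk yr) local_rep_chart.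
Unshelve. all: by end_near. Qed.

Lemma trivial_near_partial c k p i : atlas M c -> cdom c p -> K k ->
  trivial_near p ->
  'D_(delta_mx 0 i) (local_rep c k) (cmap c p) = delta_mx 0 i.
Proof.
move=> Ac cp Kk tp; rewrite (@near_eq_derive _ _ _ _ id) ?derive_id//.
have := chart_near (atlas_is_chart Ac) cp tp.
by apply: filterS => u [_ uK fixu]; rewrite /local_rep/= fixu.
Qed.

Lemma trivial_near_open : open trivial_near.
Proof. by rewrite openE => p /nbhs_interior. Qed.

(** At a limit point [q], the Hausdorff property forces [a k q = q], and continuity carries the
    identity partial derivatives over to [q]; then [tangent_identity_trivial_near] applies at
    [q]. *)
Lemma trivial_near_closed : closed trivial_near.
Proof.
move=> q clq; have [_ Mcov _] := @manifold_smooth_atlas R n M.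
have [c Ac cq] := Mcov q.
have [oD _ _ _ _] := atlas_is_chart Ac.
have cont k : a k y @[y --> q] --> a k q.
  have kq : (k, y) @[y --> q] --> (k, q) by exact: (cvg_pair (cvg_cst k) cvg_id).
  exact: (cvg_comp _ _ kq (@action_continuous k q)).
have fixq k : K k -> a k q = q.
  move=> Kk; apply/eqP; apply: contraT => kq.
  have := @manifold_hausdorff R n M; rewrite open_hausdorff => /(_ _ _ kq).
  move=> [[A B] /= [/set_mem Akq /set_mem Bq] [oA oB AB0]].
  have nAB : \forall y \near q, A (a k y) /\ B y.
    near=> y; split; last by near: y; exact: open_nbhs_nbhs.
    by near: y; apply: cont; exact: open_nbhs_nbhs.
  have [y [ty [Ay By]]] := clq _ nAB.
  move: Ay; rewrite (nbhs_singleton ty)// => Ay.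
  by have : (A `&` B) y by []; rewrite (eqP AB0).
apply: (tangent_identity_trivial_near Ac cq fixq) => k i Kk.
have cD : 'D_(delta_mx 0 i) (local_rep c k) (cmap c y) @[y --> q] -->
    'D_(delta_mx 0 i) (local_rep c k) (cmap c q).
  have kq : (k, y) @[y --> q] --> (k, q) by exact: (cvg_pair (cvg_cst k) cvg_id).
  have ckq : cdom c (a k q) by rewrite fixq.
  exact: (cvg_comp _ _ kq (@local_rep_partial_cvg _ _ _ Ac cq ckq i)).
(* If the partial derivative at [q] differed from [delta_mx 0 i], that distance would serve as the
   tolerance, contradicted by a nearby [y] where the value is exactly [delta_mx 0 i]. *)
apply/eqP; apply: contraT; rewrite -subr_eq0 -normr_gt0 => D0.
have /cvgrPdist_lt/(_ _ D0) nD := cD.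
have nDc : \forall y \near q, cdom c y /\
    `|'D_(delta_mx 0 i) (local_rep c k) (cmap c q) -
      'D_(delta_mx 0 i) (local_rep c k) (cmap c y)| <
    `|'D_(delta_mx 0 i) (local_rep c k) (cmap c q) - delta_mx 0 i|.
  by apply: filterI nD; exact: open_nbhs_nbhs.
have [y [ty [cy]]] := clq _ nDc.
by rewrite (trivial_near_partial i Ac cy Kk ty) ltxx.
Unshelve. all: by end_near. Qed.

(** The part of the component where [K] is locally trivial is nonempty, open and closed in it. *)
Lemma trivial_near_component p : trivial_near p ->
  connected_component [set: M] p `<=` trivial_near.
Proof.
move=> tp; set C := connected_component _ _.
have /(_ (C `&` trivial_near)) CE := @component_connected M setT p.
rewrite -/C in CE; rewrite -CE; first exact: subIsetr.
- by exists p; split=> //; exact: connected_component_refl.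
- by exists trivial_near => //; exact: trivial_near_open.
- by exists trivial_near => //; exact: trivial_near_closed.
Qed.

End smooth_actions.

(** * From fixed frames to identity differentials, and the theorem *)

Lemma linear_eq_delta {R : realType} {m n} (A B : {linear 'rV[R]_m -> 'rV[R]_n})
    (v : 'rV[R]_m) :
  (forall i, A (delta_mx 0 i) = B (delta_mx 0 i)) -> A v = B v.
Proof.
move=> AB; rewrite (row_sum_delta v) !linear_sum; apply: eq_bigr => i _.
by rewrite !linearZ AB.
Qed.

Lemma diff_fixed_range {R : realType} {m n} (f : 'rV[R]_m -> 'rV[R]_n)
    (g : 'rV[R]_n -> 'rV[R]_n) x y :
  f x = y -> differentiable f x -> differentiable g y ->
  (forall i, 'D_(delta_mx 0 i) (g \o f) x = 'D_(delta_mx 0 i) f x) ->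
  forall v, 'd g y ('d f x v) = 'd f x v.
Proof.
move=> fx df dg Dgf v; apply: (@linear_eq_delta _ _ _ ('d g y \o 'd f x)) => i.
by rewrite -(deriveE _ df) -Dgf (derive_comp _ fx df dg).
Qed.

(** By the chain rule the differential of [h_k] fixes the range of that of [cmap c \o psi], and this
    range is the whole space. *)
Lemma same_jet1_tangent_identity {R : realType} {d n} {G : lieGroupType R d}
    {M : manifoldType R n} {a : G -> M -> M} (smooth_a : smooth_action a)
    (c : chart R n M) k psi :
  local_diffeo psi -> atlas M c -> cdom c (psi 0) -> a k (psi 0) = psi 0 ->
  (forall i, 'D_(delta_mx 0 i) (cmap c \o (a k \o psi)) 0 =
    'D_(delta_mx 0 i) (cmap c \o psi) 0) ->
  forall i, 'D_(delta_mx 0 i) (local_rep a c k) (cmap c (psi 0)) = delta_mx 0 i.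
Proof.
move=> lpsi Ac c0 fix0 jet1 i.
have dpsi := local_diffeo_differentiable lpsi Ac c0.
have c0' : cdom c (a k (psi 0)) by rewrite fix0.
have drep := local_rep_differentiable smooth_a Ac c0 c0'.
have [oD _ cK _ _] := atlas_is_chart Ac.
have rep_psi j : 'D_(delta_mx 0 j) (local_rep a c k \o (cmap c \o psi)) 0 =
    'D_(delta_mx 0 j) (cmap c \o psi) 0.
  (* The two maps agree only where [psi t] lies in [cdom c], that is, near [0]. *)
  rewrite -jet1; apply: near_eq_derive; near=> t.
  rewrite /= local_rep_chart//; near: t.
  by apply: (local_diffeo_continuous lpsi); exact: open_nbhs_nbhs.
have dfix := diff_fixed_range (erefl : (cmap c \o psi) 0 = cmap c (psi 0))
  dpsi drep rep_psi.
rewrite (deriveE (delta_mx 0 i) drep).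
by have [w <-] := local_diffeo_surjective lpsi Ac c0 (delta_mx 0 i).
Unshelve. all: by end_near. Qed.

Theorem lemma5p1 (R : realType) (d n : nat)
    (G : lieGroupType R d) (M : manifoldType R n) (a : G -> M -> M)
    (smooth_a : smooth_action a) (effective_a : component_effective a)
    (l : nat) (l_ge1 : (1 <= l)%N)
    (x : set ('rV[R]_n -> M)) (x_frame : frame_bundle M l x) :
  forall K : set G,
    K `<=` Stab (prolong a l) x -> group_closed (mem K) -> compact K ->
    K = [set 1%g].
Proof.
move=> K Kstab groupK compactK.
have [phi lphi xE] := x_frame.
have xphi : x phi by rewrite -xE; split.
have [_ Mcov _] := @manifold_smooth_atlas R n M.
have [c Ac cp] := Mcov (phi 0).
have jets k : K k -> a k (phi 0) = phi 0 /\ forall i,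
    'D_(delta_mx 0 i) (local_rep a c k) (cmap c (phi 0)) = delta_mx 0 i.
  (* Membership of [phi] in the prolonged frame supplies some [psi] in [x], possibly other than
     [phi]. Both [psi] and [a k \o psi] have the jet of [phi], so they agree to first order because
     [1 <= l]. *)
  move=> /Kstab kx; have : prolong a l k x phi by rewrite kx.
  move=> [psi]; rewrite -xE => -[lpsi [phipsi0 phipsi]] [_ [kpsi0 kpsi]].
  rewrite /= -phipsi0 in kpsi0.
  split=> // i; rewrite phipsi0; move: i.
  apply: same_jet1_tangent_identity => //; [by rewrite -phipsi0..|] => i.
  have := kpsi c Ac; rewrite /= -phipsi0 kpsi0 => /(_ cp [:: i] l_ge1) /= ->.
  exact: (phipsi c Ac cp [:: i] l_ge1).
have trivp : trivial_near a K (phi 0).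
  apply: (tangent_identity_trivial_near smooth_a groupK compactK Ac cp).
    by move=> k /jets[].
  by move=> k i /jets[].
have trivC := trivial_near_component smooth_a groupK compactK trivp.
apply/seteqP; split=> [k Kk|_ ->]; last by have [/set_mem] := groupK.
apply: contrapT => /effective_a k1.
(* A nontrivial [k] would move some point of the component of [phi 0], where [K] acts trivially. *)
have [|y Cy] := k1 (connected_component setT (phi 0)); first by exists (phi 0).
by apply; exact: (nbhs_singleton (trivC _ Cy)).
Qed.
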